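(* Let $\mathcal K\subset\mathbb R^d$ be compact and convex and $f:\mathcal K\to\mathbb R$ convex (possibly non-smooth). Suppose a stochastic first-order oracle returns, at a query point $x\in\mathcal K$, a vector $\tilde\nabla f(x)$ with $\mathbb E[\tilde\nabla f(x)\mid x]=\nabla f(x)$ (a subgradient of $f$ at $x$) and $\|\tilde\nabla f(x)\|_\ast\le G$ almost surely. Run UniXGrad (defined in the context) with $g_t=\tilde\nabla f(\bar x_t)$ and $M_t=\tilde\nabla f(\tilde z_t)$ (so that the learning rate is computed from these stochastic vectors). Then \[ \mathbb E[f(\bar x_T)]-\min_{x\in\mathcal K}f(x)\le\frac{6D}{T^2}+\frac{14GD}{\sqrt T}. \]
   Context: Let $\|\cdot\|$ be a norm on $\mathbb R^d$ with dual norm $\|\cdot\|_\ast$. Let $\mathcal R:\mathcal K\to\mathbb R$ be differentiable and $1$-strongly convex w.r.t. $\|\cdot\|$, with Bregman divergence $D_{\mathcal R}(x,y)=\mathcal R(x)-\mathcal R(y)-\langle\nabla\mathcal R(y),x-y\rangle$, and let $D>0$ satisfy $D^2=\sup_{x,y\in\mathcal K}D_{\mathcal R}(x,y)$. UniXGrad: fix $T$, $y_0\in\mathcal K$, weights $\alpha_t=t$, $A_t=\sum_{i=1}^t\alpha_i$. For $t=1,\dots,T$: set $\tilde z_t=\frac{1}{A_t}\big(\alpha_t y_{t-1}+\sum_{i=1}^{t-1}\alpha_i x_i\big)$, obtain $M_t$ from the oracle at $\tilde z_t$, and with learning rate $\eta_t=\frac{2D}{\sqrt{1+\sum_{i=1}^{t-1}\alpha_i^2\|g_i-M_i\|_\ast^2}}$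 compute $x_t=\arg\min_{x\in\mathcal K}\alpha_t\langle x,M_t\rangle+\frac1{\eta_t}D_{\mathcal R}(x,y_{t-1})$; then set $\bar x_t=\frac1{A_t}\sum_{i=1}^t\alpha_i x_i$, obtain $g_t$ from the oracle at $\bar x_t$, and compute $y_t=\arg\min_{y\in\mathcal K}\alpha_t\langle y,g_t\rangle+\frac1{\eta_t}D_{\mathcal R}(y,y_{t-1})$. Output $\bar x_T$. *)

(* Defs.v *)
From mathcomp Require Import all_boot all_algebra all_classical all_reals all_analysis.
Import GRing.Theory Num.Theory numFieldNormedType.Exports numFieldTopology.Exports.
Set Implicit Arguments.
Unset Strict Implicit.
Unset Printing Implicit Defensive.
Local Open Scope classical_set_scope.
Local Open Scope ring_scope.

Section UniXGradDefs.
Variables (R : realType) (d : nat).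
Local Notation V := 'rV[R]_d.

Definition dotv (x y : V) : R := \sum_(i < d) x ord0 i * y ord0 i.

Definition is_norm (nrm : V -> R) : Prop :=
  [/\ forall x, nrm x = 0 -> x = 0,
      forall (a : R) x, nrm (a *: x) = `|a| * nrm x
    & forall x y, nrm (x + y) <= nrm x + nrm y].

Definition dual_norm (nrm : V -> R) (g : V) : R :=
  sup [set dotv g x | x in [set x | nrm x <= 1]].

Definition subgradient (K : set V) (f : V -> R) (x s : V) : Prop :=
  forall y, K y -> f x + dotv s (y - x) <= f y.

Definition bregman (Rf : V -> R) (x y : V) : R :=
  Rf x - Rf y - 'd Rf y (x - y).

Definition strongly_convex1 (K : set V) (nrm : V -> R) (Rf : V -> R) : Prop :=
  forall x y, K x -> K y -> Rf y + 'd Rf y (x - y) + (nrm (x - y)) ^+ 2 / 2 <= Rf x.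

(* a chosen minimizer of phi over K (default x0 if none exists) *)
Definition argminK (K : set V) (phi : V -> R) (x0 : V) : V :=
  xget x0 [set x | K x /\ forall u, K u -> phi x <= phi u].

Definition alpha (t : nat) : R := t%:R.
Definition Acoef (t : nat) : R := \sum_(1 <= i < t.+1) alpha i.

Definition mstep (K : set V) (Rf : V -> R) (a : R) (g : V) (eta : R) (y : V) : V :=
  argminK K (fun x => a * dotv x g + eta^-1 * bregman Rf x y) y.

Variables (dm : measure_display) (Xi : measurableType dm).

(* State after t-1 iterations: (y_{t-1}, sum_{i<t} alpha_i x_i,
   sum_{i<t} alpha_i^2 ||g_i - M_i||_*^2).
   The oracle [orc h q xi] returns the stochastic (sub)gradient at the query
   point q, given the history h of previous oracle noises and the fresh noise xi. *)
Definition uxg_step (K : set V) (nrm : V -> R) (Rf : V -> R) (D : R)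
    (orc : seq Xi -> V -> Xi -> V) (t : nat) (st : V * V * R) (h : seq Xi)
    (xi xi' : Xi) : V * V * R :=
  let: (y, sx, acc) := st in
  let zt := (Acoef t)^-1 *: (alpha t *: y + sx) in
  let Mt := orc h zt xi in
  let eta := 2 * D / Num.sqrt (1 + acc) in
  let xt := mstep K Rf (alpha t) Mt eta y in
  let sx' := sx + alpha t *: xt in
  let xbar := (Acoef t)^-1 *: sx' in
  let gt := orc (rcons h xi) xbar xi' in
  let yt := mstep K Rf (alpha t) gt eta y in
  (yt, sx', acc + (alpha t) ^+ 2 * (dual_norm nrm (gt - Mt)) ^+ 2).

(* run the iterations consuming the noise list two entries per iteration
   (one for the oracle call at z~_t, one for the call at xbar_t) *)
Fixpoint uxg_loop (K : set V) (nrm : V -> R) (Rf : V -> R) (D : R)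
    (orc : seq Xi -> V -> Xi -> V) (t : nat) (st : V * V * R) (h : seq Xi)
    (s : seq Xi) {struct s} : V * V * R :=
  match s with
  | xi :: s1 =>
      match s1 with
      | xi' :: s2 =>
          uxg_loop K nrm Rf D orc t.+1 (uxg_step K nrm Rf D orc t.+1 st h xi xi')
                   (rcons (rcons h xi) xi') s2
      | [::] => st
      end
  | [::] => st
  end.

(* output xbar_T = A_T^{-1} sum_{t<=T} alpha_t x_t, for a noise list of length 2T *)
Definition uxg_output (K : set V) (nrm : V -> R) (Rf : V -> R) (D : R)
    (orc : seq Xi -> V -> Xi -> V) (y0 : V) (T : nat) (s : seq Xi) : V :=
  (Acoef T)^-1 *: (uxg_loop K nrm Rf D orc 0 (y0, 0, 0) [::] s).1.2.

(* Expectation over n successive independent draws xi_1, ..., xi_n ~ mu of a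
   function of the noise list [:: xi_1; ...; xi_n] (iterated integral, xi_1 outermost). *)
Fixpoint iter_expect (mu : probability Xi R) (n : nat) (F : seq Xi -> \bar R) : \bar R :=
  match n with
  | 0 => F [::]
  | n1.+1 => (\int[mu]_xi iter_expect mu n1 (fun s => F (xi :: s)))%E
  end.

End UniXGradDefs.

(* Main.v *)
(** With [r_t = sqrt (1 + acc_t)], one round of UniXGrad satisfies
    [alpha_t <g_t, x_t - xs> <= Phi_{t-1} - Phi_t] along every noise sequence, for the
    potential [Phi_t = r_t (D_R(xs, y_t) / (2 D) - 3 D)]: the optimality conditions of the
    two mirror steps leave [|g_t - M_t| |x_t - y_t|], which strong convexity and AM-GM
    absorb up to a multiple of [r_t - r_{t-1}].
    The averages satisfy [alpha_t <s, x_t - xs> >= A_t (f(xbar_t) - f(xs)) -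
    A_{t-1} (f(xbar_{t-1}) - f(xs))] for every subgradient [s] at [xbar_t].
    Unbiasedness of [g_t], given [x_t], therefore makes
    [A_t (f(xbar_t) - f(xs)) + Phi_t] a supermartingale; it starts at a value [<= 0], and
    [- Phi_T <= 3 D sqrt (1 + 4 G^2 T^3)] almost surely.
    The oracle is only measurable in its fresh noise, so intermediate expectations may be
    integrals of non-measurable functions. The backward induction needs only monotonicity
    of the integral, since each bound is affine in [g_t] and independent of [M_t]. *)
Require Import Defs.
From mathcomp Require Import all_boot all_algebra all_classical all_reals all_analysis.
From mathcomp Require Import order ring lra measurable_realfun.
Import Order.TTheory GRing.Theory Num.Theory numFieldNormedType.Exports numFieldTopology.Exports.
Local Open Scope classical_set_scope.
Local Open Scope ring_scope.

(** * Monotonicity and integrability under weak measurability *)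

Section IntegralBounds.
Context {d} {T : measurableType d} {R : realType} (mu : {measure set T -> \bar R}).
Local Open Scope ereal_scope.

(* Integrals of non-measurable functions are lower integrals of the positive part
   minus lower integrals of the negative part, hence still monotone. *)
Lemma le_integral_any (F W : T -> \bar R) :
  (forall x, F x <= W x) -> \int[mu]_x F x <= \int[mu]_x W x.
Proof.
have ge0_le (f g : T -> \bar R) : (forall x, 0 <= f x) -> (forall x, f x <= g x) ->
    \int[mu]_x f x <= \int[mu]_x g x.
  move=> f0 fg; rewrite !ge0_integralTE//; last by move=> x; exact: le_trans (fg x).
  apply: le_ereal_sup => _ [h hf <-]; exists h => // x.
  exact: le_trans (hf x) (fg x).
move=> FW; rewrite integralE [leRHS]integralE leeB//.
- apply: ge0_le => x; first exact: funepos_ge0.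
  by apply: (@funepos_le _ _ setT); rewrite ?inE.
- apply: ge0_le => x; first exact: funeneg_ge0.
  by apply: (@funeneg_le _ _ setT); rewrite ?inE.
Qed.

(** Raising [W] to [+oo] on the exceptional null set keeps its integral, since [W] is measurable,
    and makes the comparison hold everywhere; [F] stays arbitrary. *)
Lemma ae_le_integral_any (F W : T -> \bar R) : measurable_fun setT W ->
  {ae mu, forall x, F x <= W x} -> \int[mu]_x F x <= \int[mu]_x W x.
Proof.
move=> mW [N [mN muN FWN]].
pose U x := if x \in N then +oo else W x.
have mU : measurable_fun setT U.
  apply: measurable_fun_if => //.
  - by apply: (measurable_fun_bool true); rewrite setTI preimage_mem_true.
  - exact: measurable_funTS.
have -> : \int[mu]_x W x = \int[mu]_x U x.
  apply: ae_eq_integral => //; exists N; split => // x /=.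
  rewrite /U; case: ifPn => [/set_mem//|_] h.
  by exfalso; apply: h.
apply: le_integral_any => x; rewrite /U; case: ifPn => [|xN]; first by rewrite leey.
by apply: contrapT => FW; move: xN; rewrite notin_setE; apply; exact: FWN.
Qed.

(** The integral is the difference of those of the positive and negative parts, and [+oo - +oo] is
    [-oo]; a finite value therefore forces both to be finite. *)
Lemma integrable_of_fin_integral (F : T -> R) (c : R) : measurable_fun setT F ->
  \int[mu]_x (F x)%:E = c%:E -> mu.-integrable setT (EFin \o F).
Proof.
move=> mF Fc; have mEF : measurable_fun setT (EFin \o F) by exact/measurable_EFinP.
apply/integrableP; split => //.
have -> : (fun x => `|(EFin \o F) x|) = (EFin \o F)^\+ \+ (EFin \o F)^\- by rewrite -fune_abse.
rewrite ge0_integralD//; [|exact: measurable_funepos|exact: measurable_funeneg].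
move: Fc; rewrite integralE.
have := integral_ge0 (D := setT) mu (f := (EFin \o F)^\+) (fun x _ => funepos_ge0 _ x).
have := integral_ge0 (D := setT) mu (f := (EFin \o F)^\-) (fun x _ => funeneg_ge0 _ x).
move: (integral _ _ _) (integral _ _ _) => [b| |] [a| |] //= _ _ _.
by rewrite -EFinD ltry.
Qed.
End IntegralBounds.

(** * Bilinearity, continuity and integration of the dot product *)

Section DotProduct.
Context {R : realType} {d : nat}.
Implicit Types u v w : 'rV[R]_d.

Lemma dotvBl u v w : dotv (u - v) w = dotv u w - dotv v w.
Proof. by rewrite -sumrB; apply: eq_bigr => i _; rewrite !mxE mulrBl. Qed.

Lemma dotvDr u v w : dotv u (v + w) = dotv u v + dotv u w.
Proof. by rewrite -big_split; apply: eq_bigr => i _; rewrite !mxE mulrDr. Qed.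

Lemma dotvZr (a : R) u v : dotv u (a *: v) = a * dotv u v.
Proof. by rewrite mulr_sumr; apply: eq_bigr => i _; rewrite !mxE; ring. Qed.

Lemma dotvNr u v : dotv u (- v) = - dotv u v.
Proof. by rewrite -scaleN1r dotvZr mulN1r. Qed.

Lemma dotvBr u v w : dotv u (v - w) = dotv u v - dotv u w.
Proof. by rewrite dotvDr dotvNr. Qed.

Lemma dotvC u v : dotv u v = dotv v u.
Proof. by apply: eq_bigr => i _; rewrite mulrC. Qed.

Lemma dotv_continuous u : continuous (dotv u).
Proof.
have -> : dotv u = (fun x : 'rV[R]_d => \sum_(i < d) u ord0 i * x ord0 i) by [].
apply: continuous_big => [|i _ x]; first exact: add_continuous.
by apply: continuousM; [exact: cst_continuous|exact: coord_continuous].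
Qed.

Lemma measurable_dotv {dm} {T : measurableType dm} (g : T -> 'rV[R]_d) v :
  (forall i, measurable_fun setT (fun x => g x ord0 i)) ->
  measurable_fun setT (fun x => dotv (g x) v).
Proof.
move=> mg; apply: measurable_sum => i.
by apply: measurable_funM; [exact: mg|exact: measurable_cst].
Qed.

Lemma integral_dotv {dm} {T : measurableType dm} (mu : {measure set T -> \bar R})
    (g : T -> 'rV[R]_d) (s v : 'rV[R]_d) :
  (forall i, measurable_fun setT (fun x => g x ord0 i)) ->
  (forall i, \int[mu]_x (g x ord0 i)%:E = (s ord0 i)%:E)%E ->
  mu.-integrable setT (fun x => (dotv (g x) v)%:E) /\
  (\int[mu]_x (dotv (g x) v)%:E = (dotv s v)%:E)%E.
Proof.
move=> mg gs.
have ig i : mu.-integrable setT (fun x => (g x ord0 i)%:E).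
  exact: integrable_of_fin_integral (mg i) (gs i).
have igv i : mu.-integrable setT (fun x => ((v ord0 i)%:E * (g x ord0 i)%:E)%E).
  exact: integrableZl (ig i).
have E x : (dotv (g x) v)%:E = (\sum_(i < d) (v ord0 i)%:E * (g x ord0 i)%:E)%E.
  by rewrite sumEFin; congr EFin; apply: eq_bigr => i _; rewrite mulrC.
split; first by under eq_fun do rewrite E; exact: integrable_sum.
under eq_integral do rewrite E.
rewrite integral_sum// dotvC -sumEFin; apply: eq_bigr => i _.
by rewrite integralZl// gs.
Qed.
End DotProduct.

(** * Equivalence of norms and the dual norm *)

Section DualNorm.
Context {R : realType} {d : nat} (nrm : 'rV[R]_d -> R).
Hypothesis nrmP : is_norm nrm.
Implicit Types g x y : 'rV[R]_d.

Lemma nrmZ (a : R) x : nrm (a *: x) = `|a| * nrm x.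
Proof. by case: nrmP. Qed.

Lemma nrm_triangle x y : nrm (x + y) <= nrm x + nrm y.
Proof. by case: nrmP. Qed.

Lemma nrm0 : nrm 0 = 0.
Proof. by rewrite -(scale0r (0 : 'rV[R]_d)) nrmZ normr0 mul0r. Qed.

Lemma nrmN x : nrm (- x) = nrm x.
Proof. by rewrite -scaleN1r nrmZ normrN1 mul1r. Qed.

Lemma nrm_ge0 x : 0 <= nrm x.
Proof. by have := nrm_triangle x (- x); rewrite subrr nrm0 nrmN; lra. Qed.

Lemma coord_le_mx_norm x i : `|x ord0 i| <= `|x|.
Proof.
rewrite [leRHS]/Num.Def.normr/= mx_normrE.
by apply: (le_bigmax _ (fun ij => `|x ij.1 ij.2|) (ord0, i)).
Qed.

Lemma nrm_le_mx_norm x :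
  nrm x <= `|x| * \sum_(i < d) nrm (delta_mx ord0 i).
Proof.
have nrm_sum (r : seq 'I_d) (F : 'I_d -> 'rV[R]_d) :
    nrm (\sum_(i <- r) F i) <= \sum_(i <- r) nrm (F i).
  elim: r => [|i r IH]; first by rewrite !big_nil nrm0.
  by rewrite !big_cons (le_trans (nrm_triangle _ _))// lerD2l.
rewrite {1}(row_sum_delta x) mulr_sumr (le_trans (nrm_sum _ _))//.
apply: ler_sum => i _; rewrite nrmZ ler_wpM2r ?nrm_ge0//.
exact: coord_le_mx_norm.
Qed.

Lemma nrm_continuous : continuous nrm.
Proof.
set C := \sum_(i < d) nrm (delta_mx ord0 i).
have C0 : 0 <= C by apply: sumr_ge0 => i _; exact: nrm_ge0.
have lip x y : `|nrm x - nrm y| <= `|x - y| * C.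
  have H u v : nrm u - nrm v <= `|u - v| * C.
    rewrite (le_trans _ (nrm_le_mx_norm _))// lerBlDr.
    by rewrite (le_trans _ (nrm_triangle _ _))// subrK.
  by rewrite ler_norml lerNl opprB H andbT distrC H.
move=> x; apply/(@cvgrPdist_lt _ _ _ (nbhs x) (nbhs_filter x)) => e e0.
have e'0 : 0 < e / (C + 1) by rewrite divr_gt0// ltr_wpDl.
apply/nbhs_ballP; exists (e / (C + 1)) => //= y; rewrite -ball_normE /=.
rewrite ltr_pdivlMr ?ltr_wpDl// => h; rewrite (le_lt_trans (lip _ _))//.
by rewrite (le_lt_trans _ h)// ler_wpM2l// lerDl.
Qed.

(** [nrm] attains its minimum on the compact unit sphere of the sup norm; definiteness makes it
    positive, and homogeneity extends the bound. *)
Lemma mx_norm_le_nrm : exists2 m : R, 0 < m & forall x, m * `|x| <= nrm x.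
Proof.
pose S := [set x : 'rV[R]_d | `|x| = 1].
(* An empty sphere means that [0] is the only vector, so any [m] works. *)
have [S0|/set0P S0] := eqVneq S set0.
  exists 1 => // x; have [->|x0] := eqVneq x 0; first by rewrite normr0 mulr0 nrm_ge0.
  exfalso; have : S (`|x|^-1 *: x) by rewrite /S /= normrZ normfV normr_id mulVf// normr_eq0.
  by rewrite S0.
have cS : compact S.
  apply: bounded_closed_compact.
    by exists 1; split => // M M1 x /= ->; exact: ltW.
  have -> : S = (fun x : 'rV[R]_d => `|x|) @^-1` [set 1] by [].
  by apply: closed_comp => [x _|]; [exact: norm_continuous|exact: closed_eq].
have [c /set_mem /= Sc minc] := EVT_min_rV S0 cS (continuous_subspaceT nrm_continuous).
exists (nrm c) => [|x].
  rewrite lt_neqAle nrm_ge0 andbT eq_sym; apply/eqP => c0.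
  have [/(_ _ c0) c00 _ _] := nrmP.
  by move: Sc; rewrite /S /= c00 normr0 => /eqP; rewrite eq_sym oner_eq0.
have [->|x0] := eqVneq x 0; first by rewrite normr0 mulr0 nrm_ge0.
have x0' : 0 < `|x| by rewrite normr_gt0.
have : nrm c <= nrm (`|x|^-1 *: x).
  by apply/minc/mem_set; rewrite /S /= normrZ normfV normr_id mulVf// normr_eq0.
by rewrite nrmZ normfV normr_id mulrC ler_pdivlMr.
Qed.

(** Without this, the real-valued [sup] in [dual_norm] could be a default value. *)
Lemma has_sup_dual_norm g : has_sup [set dotv g x | x in [set x | nrm x <= 1]].
Proof.
split; first by exists (dotv g 0), 0 => //=; rewrite nrm0.
have [m m0 mP] := mx_norm_le_nrm.
exists (\sum_(i < d) `|g ord0 i| * m^-1) => _ [x /= x1 <-].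
apply: ler_sum => i _; rewrite (le_trans (ler_norm _))// normrM ler_wpM2l//.
rewrite (le_trans (coord_le_mx_norm x i))// -[m^-1]mul1r ler_pdivlMr// mulrC.
exact: le_trans (mP x) x1.
Qed.

Lemma dotv_le_dual_norm g x : nrm x <= 1 -> dotv g x <= dual_norm nrm g.
Proof.
by move=> x1; apply: ub_le_sup; [exact: (has_sup_dual_norm g).2|exists x].
Qed.

Lemma dotv_le_dual_normM g x : dotv g x <= dual_norm nrm g * nrm x.
Proof.
have [x0|x0] := eqVneq (nrm x) 0.
  have [/(_ _ x0) -> _ _] := nrmP.
  by rewrite nrm0 mulr0 -(scale0r (0 : 'rV[R]_d)) dotvZr mul0r.
have x_gt0 : 0 < nrm x by rewrite lt_neqAle eq_sym x0 nrm_ge0.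
have := @dotv_le_dual_norm g ((nrm x)^-1 *: x).
rewrite nrmZ normfV ger0_norm ?nrm_ge0// mulVf// => /(_ (lexx _)).
by rewrite dotvZr mulrC ler_pdivrMr.
Qed.

Lemma dual_norm_ge0 g : 0 <= dual_norm nrm g.
Proof.
have := @dotv_le_dual_norm g 0; rewrite nrm0 ler01 => /(_ isT).
by rewrite -(scale0r (0 : 'rV[R]_d)) dotvZr mul0r.
Qed.

Lemma dual_norm_triangle g h :
  dual_norm nrm (g - h) <= dual_norm nrm g + dual_norm nrm h.
Proof.
apply: sup_le_ub => [|_ [x /= x1 <-]]; first exact: (has_sup_dual_norm _).1.
rewrite dotvBl lerD ?dotv_le_dual_norm// -dotvNr dotv_le_dual_norm//.
by rewrite nrmN.
Qed.
End DualNorm.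

(** * Optimality of a mirror step *)

Section MirrorStep.
Context {R : realType} {d : nat} (nrm : 'rV[R]_d -> R) (K : set 'rV[R]_d)
  (Rf : 'rV[R]_d -> R).
Implicit Types g u x y : 'rV[R]_d.

Lemma convex_set_segment x u (t : R) : convex_set K -> K x -> K u ->
  0 <= t -> t <= 1 -> K (t *: u + (1 - t) *: x).
Proof.
move=> cK Kx Ku t0 t1.
by have /set_mem := cK u x (Itv01 t0 t1) (mem_set Ku) (mem_set Kx).
Qed.

(** The differential at [v] is the limit of the difference quotients from the right, each of which
    is at least [c]. *)
Lemma le_diff_of_segment x (v : 'rV[R]_d) (c : R) : differentiable Rf x ->
  (forall t : R, 0 < t -> t <= 1 -> t * c <= Rf (t *: v + x) - Rf x) ->
  c <= 'd Rf x v.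
Proof.
move=> dRf H; rewrite -deriveE//.
have dv : derivable Rf x v by exact: diff_derivable.
rewrite /derive cvg_at_rightE//.
apply: limr_ge.
  rewrite -(cvg_at_rightE (fun h : R => h^-1 *: ((Rf \o shift x) (h *: v) - Rf x)))//.
  apply: cvg_trans dv; apply: cvg_app.
  move=> A [e egt0 Ae]; exists e => // t te tgt0; apply: Ae => //.
  exact/lt0r_neq0.
near=> t.
have t0 : 0 < t by near: t; exact: nbhs_right_gt.
have t1 : t <= 1 by near: t; apply: nbhs_right_le.
suff : c <= t^-1 * (Rf (t *: v + x) - Rf x) by [].
by rewrite ler_pdivlMl ?H.
Unshelve. all: by end_near. Qed.

Hypotheses (cptK : compact K) (cvxK : convex_set K)
  (dRf : forall x, K x -> differentiable Rf x).

Lemma bregman_lin y : K y -> exists Ly : 'rV[R]_d -> R,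
  [/\ forall u v, Ly (u + v) = Ly u + Ly v, forall (t : R) u, Ly (t *: u) = t * Ly u,
      continuous Ly, (fun x => 'd Rf y x) = Ly &
      forall x, bregman Rf x y = Rf x - Rf y - Ly (x - y)].
Proof.
move=> Ky; exists ('d Rf y); split => //.
- exact: linearD.
- by move=> t u; rewrite linearZ.
- exact/diff_continuous/dRf.
Qed.

(** First-order optimality in the direction [u - x], combined with the three-point identity for
    Bregman divergences. *)
Lemma mstepP (a eta : R) g y : 0 < eta -> K y ->
  let x := mstep K Rf a g eta y in
  K x /\ forall u, K u ->
    a * dotv g (x - u) <=
    eta^-1 * (bregman Rf u y - bregman Rf u x - bregman Rf x y).
Proof.
move=> eta0 Ky x.
have [Ly [LyD LyZ Lyc _ Bly]] := bregman_lin y Ky.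
pose phi z := a * dotv z g + eta^-1 * bregman Rf z y.
have phic z : K z -> {for z, continuous phi}.
  move=> Kz; have -> : phi = (fun z => a * dotv g z + eta^-1 * (Rf z - Rf y - (Ly z + Ly (- y)))).
    by apply/funext => u; rewrite /phi Bly dotvC LyD.
  have Ryc := differentiable_continuous (dRf _ Kz).
  apply: continuousD; apply: continuousM; try exact: cst_continuous.
    exact: dotv_continuous.
  apply: continuousB.
    by apply: continuousB; [exact: Ryc|exact: cst_continuous].
  by apply: continuousD; [exact: Lyc|exact: cst_continuous].
(* Compactness provides a minimizer, which excludes the default value of [xget]. *)
have [Kx minx] : K x /\ forall u, K u -> phi x <= phi u.
  rewrite /x /mstep /argminK; case: xgetP => [z _ //|noex].
  have {}phic : {within K, continuous phi}.
    by apply: continuous_in_subspaceT => z /set_mem; exact: phic.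
  have [c /set_mem Kc minc] := EVT_min_rV (ex_intro _ y Ky) cptK phic.
  by exfalso; apply: (noex c); split => // u Ku; exact/minc/mem_set.
have [Lx [LxD LxZ _ dLx Blx]] := bregman_lin x Kx.
split => // u Ku; clearbody x.
(* The optimality condition times [eta]: minimality of [x] is compared along the segment towards
   [u], which convexity keeps in [K]. *)
have h : Ly (u - x) - a * eta * dotv g (u - x) <= Lx (u - x).
  rewrite -dLx; apply: le_diff_of_segment => [|t t0 t1]; first exact: dRf.
  have := minx _ (convex_set_segment _ _ _ cvxK Kx Ku (ltW t0) t1).
  have -> : t *: u + (1 - t) *: x = t *: (u - x) + x.
    by rewrite scalerBr scalerBl scale1r addrCA addrC.
  rewrite /phi !Bly !(dotvC _ g) !(dotvDr, dotvZr).
  have -> : t *: (u - x) + x - y = (x - y) + t *: (u - x) by rewrite -addrA addrC.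
  rewrite !(LyD, LyZ) -(ler_pM2l eta0) !mulrDr !mulrA mulfV ?gt_eqF// !mul1r.
  lra.
have -> : x - u = - (u - x) by rewrite opprB.
rewrite dotvNr !Bly !Blx.
have -> : u - y = (u - x) + (x - y) by rewrite addrA subrK.
rewrite LyD -(ler_pM2l eta0) [leRHS]mulrA mulfV ?gt_eqF// mul1r.
lra.
Qed.

Lemma bregman_ge x y : strongly_convex1 K nrm Rf -> K x -> K y ->
  nrm (x - y) ^+ 2 / 2 <= bregman Rf x y.
Proof. by move=> sc Kx Ky; have := sc x y Kx Ky; rewrite /bregman; lra. Qed.

End MirrorStep.

(** * Regret of one round against the drop of the potential *)

Section RoundRegret.
Context {R : realType}.

(* AM-GM: [k n <= D k^2 / r' + n^2 r' / (4 D)]; the remaining slack is a multiple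
   of [r' - r] because [k^2 = r'^2 - r^2]. *)
Lemma potential_drop (D r r' k n b b' : R) : 0 < D -> 0 < r -> r <= r' ->
  k ^+ 2 = r' ^+ 2 - r ^+ 2 -> n ^+ 2 / 2 <= D ^+ 2 -> b' <= D ^+ 2 ->
  k * n + r / (2 * D) * (b - b' - n ^+ 2 / 2) <=
  r * (b / (2 * D) - 3 * D) - r' * (b' / (2 * D) - 3 * D).
Proof.
move=> D0 r0 rr' k2 nD b'D.
have r'0 : 0 < r' by exact: lt_le_trans rr'.
have D2 : 0 < (2 * D)^-1 by rewrite invr_gt0 mulr_gt0.
have amgm : k * n <= D * (k ^+ 2 / r') + n ^+ 2 / 2 * (r' * (2 * D)^-1).
  rewrite -subr_ge0.
  have -> : D * (k ^+ 2 / r') + n ^+ 2 / 2 * (r' * (2 * D)^-1) - k * n =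
      (2 * D * k - n * r') ^+ 2 / (4 * D * r').
    by field; rewrite !gt_eqF.
  by rewrite divr_ge0 ?sqr_ge0// ltW// !mulr_gt0.
(* Here [k^2 = (r' - r) (r' + r)] and [r' + r <= 2 r']. *)
have k2r' : k ^+ 2 / r' <= 2 * (r' - r).
  by rewrite ler_pdivrMr// k2; nra.
have dr : 0 <= (r' - r) * (2 * D)^-1 by rewrite mulr_ge0 ?subr_ge0// ltW.
have DDV : D ^+ 2 * ((r' - r) * (2 * D)^-1) = (r' - r) * (D / 2).
  by field; rewrite gt_eqF.
(* The [3 D] of the potential is spent as [D / 2] here, [D / 2] in [h2] and [2 D] in [h3]. *)
have h1 : n ^+ 2 / 2 * ((r' - r) * (2 * D)^-1) <= (r' - r) * (D / 2).
  by rewrite -DDV ler_wpM2r.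
have h2 : b' * ((r' - r) * (2 * D)^-1) <= (r' - r) * (D / 2).
  by rewrite -DDV ler_wpM2r.
have h3 : D * (k ^+ 2 / r') <= D * (2 * (r' - r)) by rewrite ler_pM2l.
move: (2 * D)^-1 (k ^+ 2 / r') D2 amgm k2r' dr DDV h1 h2 h3 => i q *.
lra.
Qed.

Context {d : nat} (nrm : 'rV[R]_d -> R) (K : set 'rV[R]_d)
  (Rf : 'rV[R]_d -> R) (D : R).
Implicit Types g M x y : 'rV[R]_d.

Definition potential (xs : 'rV[R]_d) (acc : R) (y : 'rV[R]_d) : R :=
  Num.sqrt (1 + acc) * (bregman Rf xs y / (2 * D) - 3 * D).

Hypotheses (nrmP : is_norm nrm) (cptK : compact K) (cvxK : convex_set K)
  (dRf : forall x, K x -> differentiable Rf x) (scRf : strongly_convex1 K nrm Rf)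
  (D0 : 0 < D) (bregD : forall x y, K x -> K y -> bregman Rf x y <= D ^+ 2).

(** Split [<g, x - xs>] as [<g - M, x - y'> + <M, x - y'> + <g, y' - xs>]. [mstepP] bounds the last
    two terms, with comparators [y'] and [xs]; their divergences of [y'] from [y] cancel.
    [potential_drop] with [k = a |g - M|] handles the rest. *)
Lemma round_regret (a acc : R) M g y xs : 0 <= a -> 0 <= acc -> K y -> K xs ->
  let eta := 2 * D / Num.sqrt (1 + acc) in
  let x := mstep K Rf a M eta y in
  let y' := mstep K Rf a g eta y in
  let acc' := acc + a ^+ 2 * dual_norm nrm (g - M) ^+ 2 in
  [/\ K x, K y' &
    a * dotv g (x - xs) <= potential xs acc y - potential xs acc' y'].
Proof.
move=> a0 acc0 Ky Kxs eta x y' acc'.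
have r0 : 0 < Num.sqrt (1 + acc) by rewrite sqrtr_gt0 ltr_pwDl.
have acc'0 : acc <= acc' by rewrite lerDl mulr_ge0 ?sqr_ge0.
have rr' : Num.sqrt (1 + acc) <= Num.sqrt (1 + acc').
  by rewrite ler_wsqrtr// lerD2l.
have eta0 : 0 < eta by rewrite divr_gt0// mulr_gt0.
have etaV : eta^-1 = Num.sqrt (1 + acc) / (2 * D) by rewrite invf_div.
have [Kx xP] := mstepP _ _ cptK cvxK dRf a eta M y eta0 Ky.
have [Ky' y'P] := mstepP _ _ cptK cvxK dRf a eta g y eta0 Ky.
rewrite -/x in Kx xP; rewrite -/y' in Ky' y'P.
split=> //; set n := nrm (y' - x).
have gM : a * dotv (g - M) (x - y') <= a * dual_norm nrm (g - M) * n.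
  rewrite -mulrA ler_wpM2l// /n -(nrmN nrm nrmP) opprB.
  exact: dotv_le_dual_normM.
have n2 : n ^+ 2 / 2 <= bregman Rf y' x by exact: (bregman_ge nrm K).
have nD : n ^+ 2 / 2 <= D ^+ 2 by exact: le_trans n2 (bregD _ _ Ky' Kx).
have Bxy : 0 <= bregman Rf x y.
  by apply: le_trans (bregman_ge nrm K Rf _ _ scRf Kx Ky); rewrite divr_ge0 ?sqr_ge0.
have := potential_drop D _ _ (a * dual_norm nrm (g - M)) n (bregman Rf xs y)
  (bregman Rf xs y') D0 r0 rr' _ nD (bregD _ _ Kxs Ky').
rewrite !sqr_sqrtr ?exprMn; try lra.
rewrite /acc' => /(_ (ltac:(ring))); rewrite -/acc' -etaV => H.
apply: le_trans H.
have eV0 : 0 <= eta^-1 by rewrite invr_ge0 ltW.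
have := ler_wpM2l eV0 n2; have := mulr_ge0 eV0 Bxy.
have := y'P _ Kxs; have := xP _ Ky'; move: gM.
rewrite !(dotvBl, dotvBr).
move: (dual_norm _ _) (bregman _ _ _) (bregman _ _ _) (bregman _ _ _).
move=> *; lra.
Qed.
End RoundRegret.

(** * Weighted averages and the passage from regret to function values *)

Section OnlineToBatch.
Context {R : realType} {d : nat}.
Implicit Types x y : 'rV[R]_d.

Lemma AcoefS t : Acoef R t.+1 = Acoef R t + t.+1%:R.
Proof. by rewrite /Acoef big_nat_recr. Qed.

Lemma AcoefE t : Acoef R t = t%:R * (t%:R + 1) / 2.
Proof.
elim: t => [|t IH]; first by rewrite /Acoef big_geq// mul0r mul0r.
by rewrite AcoefS IH -natr1; field.
Qed.

Lemma Acoef_ge0 t : 0 <= Acoef R t.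
Proof. by rewrite AcoefE !mulr_ge0 ?addr_ge0. Qed.

Lemma Acoef_gt0 t : 0 < Acoef R t.+1.
Proof. by rewrite AcoefE !mulr_gt0// ltr_wpDl. Qed.

Variables (K : set 'rV[R]_d) (f : 'rV[R]_d -> R).

(** Covers both query points of a round: the new vector is [y] for the first and the mirror step [x]
    for the second. *)
Lemma weighted_average_in t x xb : convex_set K -> K x -> K xb ->
  K ((Acoef R t.+1)^-1 *: (Acoef R t *: xb + alpha R t.+1 *: x)).
Proof.
move=> cK Kx Kxb; have A0 := Acoef_gt0 t.
have c0 : 0 <= alpha R t.+1 / Acoef R t.+1.
  by rewrite divr_ge0 ?(ltW A0).
have c1 : alpha R t.+1 / Acoef R t.+1 <= 1.
  by rewrite ler_pdivrMr// mul1r AcoefS lerDr Acoef_ge0.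
have -> : (Acoef R t.+1)^-1 *: (Acoef R t *: xb + alpha R t.+1 *: x) =
    (alpha R t.+1 / Acoef R t.+1) *: x + (1 - alpha R t.+1 / Acoef R t.+1) *: xb.
  have -> : 1 - alpha R t.+1 / Acoef R t.+1 = (Acoef R t.+1)^-1 * Acoef R t.
    move: A0; rewrite AcoefS /alpha; move: (Acoef R t) (t.+1%:R) => A k Ak0.
    by field; rewrite gt_eqF.
  by rewrite scalerDr !scalerA addrC (mulrC (alpha R t.+1)).
exact: convex_set_segment.
Qed.

(** By definition of [xb'], the right side is [A_t <s, xb' - xb> + alpha_{t+1} <s, xb' - xs>]; the
    subgradient inequality at [xb'] bounds each term. *)
Lemma online_to_batch t x xb xs s : K xb -> K xs ->
  let xb' := (Acoef R t.+1)^-1 *: (Acoef R t *: xb + alpha R t.+1 *: x) in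
  subgradient K f xb' s ->
  Acoef R t.+1 * (f xb' - f xs) - Acoef R t * (f xb - f xs) <=
  alpha R t.+1 * dotv s (x - xs).
Proof.
move=> Kxb Kxs xb' sP; have A0 := Acoef_gt0 t.
have axE : alpha R t.+1 *: x = Acoef R t.+1 *: xb' - Acoef R t *: xb.
  by rewrite /xb' scalerA mulfV ?gt_eqF// scale1r addrC addKr.
have : alpha R t.+1 * dotv s x = Acoef R t.+1 * dotv s xb' - Acoef R t * dotv s xb.
  by rewrite -!dotvZr axE dotvBr.
have := ler_wpM2l (Acoef_ge0 t) (sP _ Kxb).
have := ler_wpM2l (ler0n R t.+1) (sP _ Kxs).
rewrite AcoefS /alpha !dotvBr => *; lra.
Qed.
End OnlineToBatch.

(** * Expectation over the oracle noise, by backward induction *)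

Lemma integral_affine_dotv {R : realType} {d : nat} {dm : measure_display}
    {T : measurableType dm} (mu : probability T R) (g : T -> 'rV[R]_d)
    (s v : 'rV[R]_d) (c : R) :
  (forall i, measurable_fun setT (fun x => g x ord0 i)) ->
  (forall i, \int[mu]_x (g x ord0 i)%:E = (s ord0 i)%:E)%E ->
  (\int[mu]_x (c + dotv (g x) v)%:E = (c + dotv s v)%:E)%E.
Proof.
move=> mg gs; have [ig gE] := integral_dotv mu g s v mg gs.
under eq_integral do rewrite EFinD.
rewrite integralD//; last exact: finite_measure_integrable_cst.
by rewrite gE integral_cst// [X in (_ * X)%E]probability_setT mule1.
Qed.

Section ExpectedGap.
Context {R : realType} {d : nat} (nrm : 'rV[R]_d -> R) (K : set 'rV[R]_d)
  (Rf : 'rV[R]_d -> R) (D : R) (f : 'rV[R]_d -> R) (G : R).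
Context {dm : measure_display} {Xi : measurableType dm} (mu : probability Xi R)
  (orc : seq Xi -> 'rV[R]_d -> Xi -> 'rV[R]_d).
Hypotheses (nrmP : is_norm nrm) (cptK : compact K) (cvxK : convex_set K)
  (dRf : forall x, K x -> differentiable Rf x) (scRf : strongly_convex1 K nrm Rf)
  (D0 : 0 < D) (bregD : forall x y, K x -> K y -> bregman Rf x y <= D ^+ 2)
  (morc : forall h x (i : 'I_d), K x ->
    measurable_fun setT (fun xi => orc h x xi ord0 i))
  (orc_unbiased : forall h x, K x -> exists s, subgradient K f x s /\
    forall i : 'I_d, (\int[mu]_xi ((orc h x xi ord0 i)%:E) = (s ord0 i)%:E)%E)
  (orc_bounded : forall h x, K x ->
    {ae mu, forall xi, dual_norm nrm (orc h x xi) <= G}).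

(** Dual norms are nonnegative, so a negative [G] would make the null exceptional set the whole
    probability space. *)
Lemma oracle_bound_ge0 (x : 'rV[R]_d) : K x -> 0 <= G.
Proof.
move=> Kx; rewrite leNgt; apply/negP => G0.
have [N [mN muN GN]] := orc_bounded [::] x Kx.
have NT : N = setT.
  apply/seteqP; split => // xi _; apply: GN => /= /(le_trans (dual_norm_ge0 nrm nrmP _)).
  by rewrite leNgt G0.
have := probability_setT mu; rewrite -NT [mu N]muN => /esym/eqP.
by rewrite onee_eq0.
Qed.

(* The value function of the backward induction: [n] rounds remain from a state reached
   through noise on which the oracle obeyed its bound. *)
Lemma expected_gap (T n t : nat) (y xb xs : 'rV[R]_d) (acc : R) (h : seq Xi) :
  (t + n = T)%N -> (0 < T)%N -> K y -> K xb -> K xs ->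
  0 <= acc -> acc <= 4 * G ^+ 2 * t%:R ^+ 3 ->
  (iter_expect mu (2 * n) (fun s => (f ((Acoef R T)^-1 *:
     (uxg_loop K nrm Rf D orc t (y, Acoef R t *: xb, acc) h s).1.2))%:E) <=
   (f xs + (Acoef R t * (f xb - f xs) + potential Rf D xs acc y +
            3 * D * Num.sqrt (1 + 4 * G ^+ 2 * T%:R ^+ 3)) / Acoef R T)%:E)%E.
Proof.
move=> tnT T0 Ky Kxb Kxs; have AT0 : 0 < Acoef R T.
  by rewrite -(prednK T0); exact: Acoef_gt0.
set B := Num.sqrt (1 + 4 * G ^+ 2 * T%:R ^+ 3).
elim: n t y xb acc h tnT Ky Kxb => [|n IH] t y xb acc h tnT Ky Kxb acc0 accG.
  rewrite addn0 in tnT; subst t.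
  rewrite muln0 /= lee_fin scalerA mulVf ?gt_eqF// scale1r.
  rewrite -addrA mulrDl mulrAC mulfV ?gt_eqF// mul1r addrA subrKC lerDl.
  rewrite divr_ge0 ?(ltW AT0)// /potential.
  have rB : Num.sqrt (1 + acc) <= B by rewrite ler_wsqrtr// lerD2l.
  have b0 : 0 <= bregman Rf xs y / (2 * D).
    rewrite divr_ge0 ?mulr_ge0 ?(ltW D0)//.
    by apply: le_trans (bregman_ge nrm K Rf _ _ scRf Kxs Ky); rewrite divr_ge0 ?sqr_ge0.
  have := mulr_ge0 (sqrtr_ge0 (1 + acc)) b0.
  have := ler_wpM2l (ltW D0) rB.
  rewrite mulrBr; lra.
rewrite mulnS /=.
set zt := (Acoef R t.+1)^-1 *: _.
have Kzt : K zt by rewrite /zt addrC; exact: weighted_average_in.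
set W : \bar R := (X in (_ <= X)%E).
(* As [mu] has mass one, it suffices to bound the inner expectation by [W] for almost every noise
   [xi] behind [M]. *)
have -> : W = (\int[mu]_x W)%E.
  by rewrite integral_cst// [X in (_ * X)%E]probability_setT mule1.
apply: ae_le_integral_any; first exact: measurable_cst.
have [N [mN muN GN]] := orc_bounded h zt Kzt.
exists N; split=> // xi /= WN; apply: GN => /= MG; apply: WN.
set M := orc h zt xi in MG *.
pose eta := 2 * D / Num.sqrt (1 + acc).
pose x := mstep K Rf (alpha R t.+1) M eta y.
have al0 : 0 <= alpha R t.+1 by rewrite ler0n.
have reg g := round_regret nrm K Rf D nrmP cptK cvxK dRf scRf D0 bregD
  (alpha R t.+1) acc M g y xs al0 acc0 Ky Kxs.
have [Kx _ _] := reg M; rewrite -/eta -/x in Kx.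
set xb' := (Acoef R t.+1)^-1 *: (Acoef R t *: xb + alpha R t.+1 *: x).
have Kxb' : K xb' by exact: weighted_average_in.
have sxE : Acoef R t *: xb + alpha R t.+1 *: x = Acoef R t.+1 *: xb'.
  by rewrite scalerA mulfV ?scale1r// gt_eqF// Acoef_gt0.
have [s [sP Es]] := orc_unbiased (rcons h xi) xb' Kxb'.
(* With [M], hence [xb'], fixed, [c + <g, v>] is the bound for the next state with its potential
   replaced, through [round_regret], by the old one minus [alpha <g, x - xs>]; it is affine in
   [g]. *)
pose c := f xs + (Acoef R t.+1 * (f xb' - f xs) + potential Rf D xs acc y +
  3 * D * B) / Acoef R T.
pose v := - (alpha R t.+1 / Acoef R T) *: (x - xs).
have dotvE u : c + dotv u v = f xs + (Acoef R t.+1 * (f xb' - f xs) +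
    potential Rf D xs acc y + 3 * D * B - alpha R t.+1 * dotv u (x - xs)) / Acoef R T.
  by rewrite /c /v dotvZr; ring.
apply: (@le_trans _ _ (\int[mu]_xi' (c + dotv (orc (rcons h xi) xb' xi') v)%:E)%E).
  apply: ae_le_integral_any.
    apply/measurable_EFinP; apply: measurable_funD; first exact: measurable_cst.
    by apply: measurable_dotv => i; exact: morc.
  have [N' [mN' muN' GN']] := orc_bounded (rcons h xi) xb' Kxb'.
  exists N'; split=> // xi' /= WN; apply: GN' => /= gG; apply: WN.
  set g := orc (rcons h xi) xb' xi' in gG *.
  rewrite -/zt -/M -/eta -/x -/xb' -/g sxE.
  have [_ Ky' gx] := reg g.
  set acc' := acc + _; set y' := mstep _ _ _ g _ _.
  rewrite add0n; apply: (le_trans (IH _ y' xb' acc' _ _ Ky' Kxb' _ _)).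
  - by rewrite addSnnS.
  - by rewrite addr_ge0// mulr_ge0 ?sqr_ge0.
  (* The invariant on [acc] persists because [t^3 + (t+1)^2 <= (t+1)^3]. *)
  - have gM2 : dual_norm nrm (g - M) ^+ 2 <= 4 * G ^+ 2.
      have := dual_norm_ge0 nrm nrmP (g - M).
      have := dual_norm_triangle nrm nrmP g M.
      move: (dual_norm _ _) (dual_norm _ _) (dual_norm _ _) gG MG => p q r *.
      have -> : 4 * G ^+ 2 = (G + G) ^+ 2 by ring.
      rewrite ler_sqr ?nnegrE; lra.
    have := ler_wpM2l (sqr_ge0 (alpha R t.+1)) gM2.
    have := mulr_ge0 (sqr_ge0 G) (ler0n R t).
    have := mulr_ge0 (sqr_ge0 G) (sqr_ge0 (t%:R : R)).
    rewrite /acc' /alpha -natr1; move: accG.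
    move: (dual_norm _ _) => p *; lra.
  - rewrite lee_fin dotvE lerD2l ler_pM2r ?invr_gt0//.
    move: gx; rewrite -/eta -/x -/y' -/acc'; lra.
(* Unbiasedness turns [g] into the subgradient [s], to which [online_to_batch] applies. *)
rewrite (integral_affine_dotv _ _ s)//; last by move=> i; exact: morc.
rewrite lee_fin dotvE lerD2l ler_pM2r ?invr_gt0//.
have := online_to_batch K f t x xb xs s Kxb Kxs sP; rewrite -/xb'; lra.
Qed.
End ExpectedGap.

(** * The explicit rate and the conclusion *)

Lemma rate_bound {R : realType} (D G : R) (T : nat) : 0 < D -> 0 <= G -> (0 < T)%N ->
  3 * D * Num.sqrt (1 + 4 * G ^+ 2 * T%:R ^+ 3) / Acoef R T <=
  6 * D / T%:R ^+ 2 + 14 * G * D / Num.sqrt T%:R.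
Proof.
move=> D0 G0 T0; set q : R := Num.sqrt T%:R.
have TR0 : 0 < T%:R :> R by rewrite ltr0n.
have q0 : 0 < q by rewrite sqrtr_gt0.
have TE : T%:R = q ^+ 2 :> R by rewrite sqr_sqrtr// ltW.
have AT : T%:R ^+ 2 / 2 <= Acoef R T by rewrite AcoefE; nra.
(* With [T = q^2], the radicand is [1 + (2 G q^3)^2], at most the square of the right side. *)
have sqrtB : Num.sqrt (1 + 4 * G ^+ 2 * T%:R ^+ 3) <= 1 + 2 * G * q ^+ 3.
  have Gq0 : 0 <= 2 * G * q ^+ 3 by rewrite mulr_ge0 ?exprn_ge0 ?(ltW q0)// mulr_ge0.
  rewrite -(@ger0_norm _ (1 + 2 * G * q ^+ 3)) ?addr_ge0// -sqrtr_sqr.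
  by rewrite ler_wsqrtr// TE; lra.
apply: (@le_trans _ _ (3 * D * (1 + 2 * G * q ^+ 3) / (T%:R ^+ 2 / 2))).
  apply: ler_pM => //.
  - by rewrite !mulr_ge0 ?sqrtr_ge0// ltW.
  - by rewrite invr_ge0 (le_trans _ AT)// divr_ge0 ?sqr_ge0.
  - by rewrite ler_pM2l// mulr_gt0.
  - by rewrite lef_pV2 ?posrE ?(lt_le_trans _ AT) ?divr_gt0 ?exprn_gt0.
rewrite TE.
(* The constant reached is [12], which is relaxed to [14]. *)
have -> : 3 * D * (1 + 2 * G * q ^+ 3) / ((q ^+ 2) ^+ 2 / 2) =
    6 * D / (q ^+ 2) ^+ 2 + 12 * G * D / q by field; rewrite gt_eqF.
rewrite lerD2l ler_pM2r ?invr_gt0// ler_pM2r// ler_wpM2r//.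
lra.
Qed.

Theorem theorem2 (R : realType) (d : nat) (nrm : 'rV[R]_d -> R)
  (K : set 'rV[R]_d) (Rf : 'rV[R]_d -> R) (D : R) (f : 'rV[R]_d -> R) (G : R)
  (dm : measure_display) (Xi : measurableType dm) (mu : probability Xi R)
  (orc : seq Xi -> 'rV[R]_d -> Xi -> 'rV[R]_d) (y0 : 'rV[R]_d) (T : nat) :
  is_norm nrm ->
  compact K -> convex_set K ->
  (forall x, K x -> differentiable Rf x) ->
  strongly_convex1 K nrm Rf ->
  0 < D ->
  (forall x y, K x -> K y -> bregman Rf x y <= D ^+ 2) ->
  D ^+ 2 = sup [set bregman Rf xy.1 xy.2 | xy in K `*` K] ->
  convex_function K f ->
  (* stochastic first-order oracle: measurable in the fresh noise, conditionally
     unbiased for a subgradient at the query point, and a.s. bounded in dual norm *)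
  (forall h x (i : 'I_d), K x -> measurable_fun setT (fun xi => orc h x xi ord0 i)) ->
  (forall h x, K x -> exists s, subgradient K f x s /\
      forall i : 'I_d, (\int[mu]_xi ((orc h x xi ord0 i)%:E) = (s ord0 i)%:E)%E) ->
  (forall h x, K x -> {ae mu, forall xi, dual_norm nrm (orc h x xi) <= G}) ->
  K y0 ->
  (1 <= T)%N ->
  forall xstar, K xstar ->
  (iter_expect mu (2 * T) (fun s => (f (uxg_output K nrm Rf D orc y0 T s))%:E)
     - (f xstar)%:E <= (6 * D / (T%:R ^+ 2) + 14 * G * D / Num.sqrt T%:R)%:E)%E.
Proof.
move=> nrmP cptK cvxK dRf scRf D0 bregD _ _ morc orc_unb orc_bnd Ky0 T0 xs Kxs.
have G0 : 0 <= G := oracle_bound_ge0 nrm K G mu orc nrmP orc_bnd y0 Ky0.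
(* The initial average may be any point of [K], here [y0], since its weight [A_0] is [0]. *)
have := expected_gap nrm K Rf D f G mu orc nrmP cptK cvxK dRf scRf D0 bregD
  morc orc_unb orc_bnd T T 0 y0 y0 xs 0 [::] (add0n T) T0 Ky0 Ky0 Kxs (lexx _).
have A0 : Acoef R 0 = 0 by rewrite AcoefE mul0r mul0r.
have z3 : (0%:R : R) ^+ 3 = 0 by rewrite expr0n.
rewrite A0 scale0r mul0r add0r z3 mulr0 => /(_ (lexx _)) H.
rewrite leeBlDr// (le_trans H)// -EFinD lee_fin [leRHS]addrC lerD2l.
apply: le_trans (rate_bound D G T D0 G0 T0).
have AT0 : 0 < Acoef R T by rewrite -(prednK T0); exact: Acoef_gt0.
(* The initial potential is at most [D / 2 - 3 D], hence nonpositive. *)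
rewrite ler_pM2r ?invr_gt0// gerDr /potential addr0 sqrtr1 mul1r subr_le0.
rewrite ler_pdivrMr ?mulr_gt0// (le_trans (bregD _ _ Kxs Ky0))//.
have := sqr_ge0 D; lra.
Qed.
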